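(* If $|a+b|>0$, then for any two distinct nonzero $\alpha_1,\alpha_2\in\mathbb{R}$, at least one of the corresponding re-weighted means is nonzero, i.e., $$\max\left(\left|\mathbb{E}_{x\sim P}\, e^{\alpha_1\|x\|^2}u^\top x\right|,\ \left|\mathbb{E}_{x\sim P}\, e^{\alpha_2\|x\|^2}u^\top x\right|\right)>0.$$
   Context: Let $\epsilon>0$ and let $q$ be a symmetric (about $0$) one-dimensional isotropic (mean $0$, variance $1$) logconcave density. Let $a<b$ satisfy $q((-\infty,a])\ge\epsilon$, $q([a,b])\ge\epsilon$, $q([b,\infty))\ge\epsilon$, where $q(I)=\int_I q$. Let $\hat q$ be the isotropized density obtained after restricting $q$ to $\mathbb{R}\setminus[a,b]$, i.e. the density of $(X-\mu_1)/\sigma_1$, where $X$ has the (renormalized) restriction of $q$ to $\mathbb{R}\setminus[a,b]$ as its density and $\mu_1,\sigma_1^2$ are its mean and variance. Let $P$ be the product distribution on $\mathbb{R}^d$ of one copy of $\hat q$ and $d-1$ copies of $q$ (a product distribution with $\epsilon$-margin, before any affine transformation), and let $u$ be the unit vector normal to the margin, i.e. the coordinate direction of the factor $\hat q$. $\|\cdot\|$ is the $l_2$ norm. *)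

(* Defs.v *)
From HB Require Import structures.
From mathcomp Require Export all_boot all_order all_algebra.
From mathcomp Require Export all_classical all_reals all_analysis.
From mathcomp Require Export measurable_realfun.

Set Implicit Arguments.
Unset Strict Implicit.
Unset Printing Implicit Defensive.

Export Order.TTheory GRing.Theory Num.Theory.
Export numFieldNormedType.Exports.

Local Open Scope classical_set_scope.
Local Open Scope ring_scope.

Record density (R : realType) := Density {
  pdf :> R -> R ;
  measurable_pdf : measurable_fun [set: R] pdf ;
  pdf_ge0 : forall x, 0 <= pdf x ;
  integral_pdf : (\int[lebesgue_measure]_x (pdf x)%:E = 1)%E }.

Definition density_prob (R : realType) (q : density R) (A : set R) : \bar R :=
  (\int[lebesgue_measure]_(x in A) (q x)%:E)%E.

Section density_prob_probability.
Context (R : realType) (q : density R).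

Let density_prob0 : density_prob q set0 = 0%E.
Proof. by rewrite /density_prob integral_set0. Qed.

Let density_prob_ge0 A : (0 <= density_prob q A)%E.
Proof. by apply: integral_ge0 => x _; rewrite lee_fin pdf_ge0. Qed.

Let density_prob_sigma_additive : semi_sigma_additive (density_prob q).
Proof.
move=> /= F mF tF mUF; rewrite /density_prob; apply: cvg_toP.
  apply: ereal_nondecreasing_is_cvgn => m n mn.
  apply: lee_sum_nneg_natr => // k _ _.
  by apply: integral_ge0 => /= x Fkx; rewrite lee_fin pdf_ge0.
rewrite ge0_integral_bigcup//=; last by move=> x _; rewrite lee_fin pdf_ge0.
by apply/measurable_EFinP/measurable_funTS; exact: measurable_pdf.
Qed.

HB.instance Definition _ := isMeasure.Build _ _ _ (density_prob q)
  density_prob0 density_prob_ge0 density_prob_sigma_additive.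

Let density_prob_setT : density_prob q [set: R] = 1%E.
Proof. exact: integral_pdf. Qed.

HB.instance Definition _ := @Measure_isProbability.Build _ _ R
  (density_prob q) density_prob_setT.

End density_prob_probability.

Definition symmetric_about0 (R : realType) (q : R -> R) : Prop :=
  forall x, q (- x) = q x.

(* The weights are strictly positive, so that [0 `^ t = 0] (recall that
   [0 `^ 0 = 1]) and the inequality is vacuous off the support of [q]. *)
Definition logconcave (R : realType) (q : R -> R) : Prop :=
  forall (x y t : R), 0 < t -> t < 1 ->
    q x `^ t * q y `^ (1 - t) <= q (t * x + (1 - t) * y).

Definition isotropic (R : realType) (Q : probability R R) : Prop :=
  ('E_Q[id : R -> R] = 0)%E /\ ('V_Q[id : R -> R] = 1)%E.

Lemma measurable_outside (R : realType) (a b : R) :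
  measurable (~` `[a, b] : set R).
Proof. exact: measurableC. Qed.

(* [mnormalize m P] is [m] divided by its total mass; [P] is only a default
   value for when that mass is [0] or [+oo]. *)
Definition restricted_prob (R : realType) (q : density R) (a b : R) :
    probability R R :=
  mnormalize (mrestr (density_prob q) (measurable_outside a b))
    (density_prob q).

Lemma restricted_probE (R : realType) (q : density R) (a b : R)
    (Z := density_prob q (~` `[a, b])) (A : set R) :
  measurable A -> (0 < Z)%E ->
  restricted_prob q a b A =
  (\int[lebesgue_measure]_(x in A)
     (if x \in `[a, b]%R then 0 else q x / fine Z)%:E)%E.
Proof.
move=> mA Z0.
have mD := measurable_outside a b.
have mq (B : set R) : measurable_fun B (fun x => (q x)%:E).
  by apply/measurable_EFinP/measurable_funTS; exact: measurable_pdf.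
have Zfin : Z \is a fin_num by rewrite /Z fin_num_measure.
have -> : restricted_prob q a b A =
    (density_prob q (A `&` ~` `[a, b]) * (fine Z)^-1%:E)%E.
  rewrite /restricted_prob /= /mnormalize /=.
  have -> : mrestr (density_prob q) (measurable_outside a b) [set: R] = Z by rewrite /mrestr setTI.
  by rewrite (gt_eqF Z0)/= -[Z]fineK.
rewrite /density_prob integral_mkcondr -ge0_integralZr//; first last.
- by rewrite lee_fin invr_ge0 fine_ge0// ltW.
- move=> x _; rewrite patchE; by case: ifP => // _; rewrite lee_fin pdf_ge0.
- apply/(measurable_restrict _ mD mA); exact: mq.
apply: eq_integral => x _; rewrite patchE; case: ifPn.
  by rewrite inE/= => /negP/negbTE ->; rewrite -EFinM.
by rewrite notin_setE/= => /contrapT ->; rewrite mul0e.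
Qed.

Definition standardize (R : realType) (m s : R) (x : R) : R := (x - m) / s.

Section standardize_measurable.
Context (R : realType) (m s : R).

Let measurable_standardize : measurable_fun [set: R] (standardize m s).
Proof. by apply: measurable_funM => //; apply: measurable_funB. Qed.

HB.instance Definition _ :=
  isMeasurableFun.Build _ _ _ _ (standardize m s) measurable_standardize.

End standardize_measurable.

Definition isotropized_prob (R : realType) (Q : probability R R) :
    probability R R :=
  let m := fine 'E_Q[id : R -> R] in
  let s := Num.sqrt (fine 'V_Q[id : R -> R]) in
  distribution Q (standardize m s).

(* The law with density the isotropized restriction of [q] to the complement of
   [[a, b]]. *)
Definition margin_factor (R : realType) (q : density R) (a b : R) :
    probability R R :=
  isotropized_prob (restricted_prob q a b).

Definition cons_pair (T : Type) n (x : T * n.-tuple T) : n.+1.-tuple T :=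
  [tuple of x.1 :: x.2].

Section cons_pair_measurable.
Context d (T : measurableType d) (n : nat).

Let measurable_cons_pair : measurable_fun [set: T * n.-tuple T] (@cons_pair T n).
Proof. exact: measurable_cons. Qed.

HB.instance Definition _ :=
  isMeasurableFun.Build _ _ _ _ (@cons_pair T n) measurable_cons_pair.

End cons_pair_measurable.

Fixpoint product_prob (R : realType) n :
    ('I_n -> probability R R) -> probability (n.-tuple R) R :=
  match n with
  | 0 => fun _ => \d_([tuple] : 0.-tuple R)
  | n'.+1 => fun mu =>
      distribution (mu ord0 \x product_prob (fun i => mu (lift ord0 i)))%E
        (@cons_pair R n')
  end.

Lemma product_probE (R : realType) n (mu : 'I_n -> probability R R)
    (A : 'I_n -> set R) : (forall i, measurable (A i)) ->
  product_prob mu [set x | forall i, A i (tnth x i)] = (\prod_i mu i (A i))%E.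
Proof.
elim: n mu A => [|n IHn] mu A mA.
  rewrite big_ord0 /= diracE mem_set//= => -[] //.
rewrite big_ord_recl /= -IHn// /distribution /pushforward.
rewrite -product_measure1E//.
  congr (_ _); apply/seteqP; split => [[x t]/= xtA|[x t]/= [xA tA] i].
    split; first exact: (xtA ord0).
    by move=> i; have := xtA (lift ord0 i); rewrite tnthS.
  by have [j ->|->//] := unliftP ord0 i; rewrite tnthS.
rewrite [X in measurable X](_ : _ = \bigcap_(i in [set: 'I_n])
    (fun x : n.-tuple R => tnth x i) @^-1` A (lift ord0 i)).
  apply: fin_bigcap_measurable => //= i _.
  by rewrite -[X in measurable X]setTI; exact: measurable_tnth.
by apply/seteqP; split => [x xA i _|x xA i]; [exact: xA|exact: (xA i)].
Qed.

Definition margin_product (R : realType) (q : density R) (a b : R) d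
    (k : 'I_d) : probability (d.-tuple R) R :=
  product_prob
    (fun i => if i == k then margin_factor q a b else density_prob q).

(* The norm of the library on row vectors is the sup norm, hence this explicit
   Euclidean norm. *)
Definition l2norm (R : realType) d (x : d.-tuple R) : R :=
  Num.sqrt (\sum_(i < d) tnth x i ^+ 2).

Definition dot (R : realType) d (u x : d.-tuple R) : R :=
  \sum_(i < d) tnth u i * tnth x i.

Definition basis_vector (R : realType) d (k : 'I_d) : d.-tuple R :=
  [tuple (i == k)%:R | i < d].

(* The expectation is extended-real valued and needs no integrability
   assumption. If the integrand is not [P]-integrable (possible for
   [alpha > 0]), the value is infinite; in particular the undefined case
   [+oo - oo] is [-oo]. *)
Definition reweighted_mean (R : realType) d (P : probability (d.-tuple R) R)
    (u : d.-tuple R) (alpha : R) : \bar R :=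
  ('E_P[fun x => (expR (alpha * l2norm x ^+ 2) * dot u x)%R])%E.

(* Main.v *)
Require Import Defs.
From mathcomp Require Import ring lra.

(* By Tonelli the factors other than the [k]-th contribute a positive, possibly
   infinite, constant, so a vanishing re-weighted mean says that
   [int_(x notin [a, b]) exp(be (x - m)^2) (x - m) q(x) dx = 0], with [m] and
   [v] the mean and variance of the restriction and [be = alpha / v]. This also
   holds for [be = 0] by definition of [m]. If both means vanished, the integral
   would thus vanish for three exponents [0, b1, b2].
   By reflection assume [a + b > 0]; then [m < 0]. Folding at [m] with
   [y = x - m], the density [q(m + y) - q(m - y)], restricted off the margin, is
   on [y > 0] nonpositive for [y] in [[a - m, b - m]] and nonnegative elsewhere,
   because [q] is even and decreasing in [|x|]: it has at most two sign changes.
   A combination [p(s) = A + B exp(b1 s) + C exp(b2 s)] with the same sign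
   pattern in [s = y^2] gives a nonnegative integrand of integral zero, so the
   folded density vanishes almost everywhere. This makes [q] constant on
   [[c, +oo[] for some [c] with [q c > 0], against integrability. *)

Set Implicit Arguments.
Unset Strict Implicit.
Unset Printing Implicit Defensive.

Local Open Scope classical_set_scope.
Local Open Scope ring_scope.

(** * Reflections of the line and integrals equal to zero *)

Section reflection.
Context (R : realType).
Local Notation mu := (@lebesgue_measure R).

Lemma ae_exists_itv (P : R -> Prop) (a b : R) :
  a < b -> {ae mu, forall x, P x} -> exists2 x, a < x < b & P x.
Proof.
move=> ab [N [mN N0 PN]]; apply: contrapT => noP.
have abN : `]a, b[ `<=` N.
  move=> x /=; rewrite in_itv/= => xab; apply: PN => Px.
  by apply: noP; exists x.
have : (mu `]a, b[ <= mu N)%E by apply: le_measure => //; rewrite inE.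
rewrite N0 lebesgue_measure_itv/= lte_fin ab -EFinD lee_fin leNgt.
by rewrite subr_gt0 ab.
Qed.

Lemma integral_reflect (c : R) (f : R -> R) :
    mu.-integrable setT (EFin \o f) ->
  mu.-integrable setT (EFin \o (fun x => f (c - x))) /\
  (\int[mu]_x (f (c - x))%:E = \int[mu]_x (f x)%:E)%E.
Proof.
move=> intf; have mf : measurable_fun setT f.
  by apply/measurable_EFinP; exact: measurable_int intf.
pose phi : measurableTypeR R -> measurableTypeR R := fun x => c - x.
have mphi : measurable_fun setT phi by apply: measurable_funB.
(* Uniqueness of Lebesgue measure reduces this to the intervals []x, y]], whose preimage is [[c - y,
   c - x[]. *)
have muphi A : measurable A -> mu A = pushforward mu phi A.
  apply: lebesgue_measure_unique => _ [[x y] _ <-].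
  transitivity (mu `[c - y, c - x[%classic); last first.
    congr (mu _); apply/seteqP.
    split => z /=; rewrite !in_itv/= /phi => /andP[? ?];
      apply/andP; split; lra.
  rewrite !lebesgue_measure_itv/= !lte_fin ltrD2l ltrN2.
  by case: ifPn => // _; rewrite -!EFinD; congr EFin; ring.
have phiphi : phi \o phi = id by apply/funext => x /=; rewrite /phi; ring.
have intphi : mu.-integrable setT (EFin \o (f \o phi)).
  apply/integrableP; split.
    by apply/measurable_EFinP; exact: measurableT_comp.
  have /integrableP[_] := intf; congr (_ < _)%E.
  rewrite (@eq_measure_integral _ _ _ _ (pushforward mu phi)); last first.
    by move=> A mA _; exact: muphi.
  rewrite ge0_integral_pushforward//.
  exact/measurableT_comp/measurable_EFinP.
split => //; rewrite [RHS](@eq_measure_integral _ _ _ _ (pushforward mu phi));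
  last by move=> A mA _; exact: muphi.
by rewrite integral_pushforward//; exact/measurable_EFinP.
Qed.

(** Reflection preserves the integral, so the folded function also has integral zero; being
    nonnegative, it vanishes almost everywhere. *)
Lemma ae_eq0_reflect (c : R) (f : R -> R) :
    mu.-integrable setT (EFin \o f) -> (\int[mu]_x (f x)%:E = 0)%E ->
    (forall x, 0 <= f x + f (c - x)) ->
  {ae mu, forall x, f x + f (c - x) = 0}.
Proof.
move=> intf f0 fge0; have [intg g0] := integral_reflect c intf.
have := integralD_EFin measurableT intf intg.
rewrite /= g0 f0 adde0 => int0.
have mF : measurable_fun setT (fun x => (f x + f (c - x))%:E).
  exact: measurable_int (integrableD measurableT intf intg).
have : (\int[mu]_x `|(f x + f (c - x))%:E| = 0)%E.
  by rewrite -int0; apply: eq_integral => x _; rewrite gee0_abs ?lee_fin.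
move/(ae_eq_integral_abs mu measurableT mF); apply: filterS => x /(_ I)[].
exact.
Qed.

(** The positive and negative parts cannot both have integral [+oo], since [+oo - oo] is [-oo], and
    a single infinite one gives an infinite value; so both are finite. *)
Lemma integral_eq0_integrable d (T : measurableType d)
    (nu : {measure set T -> \bar R}) (f : T -> \bar R) :
  measurable_fun setT f -> (\int[nu]_x f x = 0)%E -> nu.-integrable setT f.
Proof.
move=> mf; rewrite integralE => fpm.
have p0 : (0 <= \int[nu]_x f^\+ x)%E by apply: integral_ge0.
have n0 : (0 <= \int[nu]_x f^\- x)%E by apply: integral_ge0.
have mp : measurable_fun setT f^\+%E by exact: measurable_funepos.
have mn : measurable_fun setT f^\-%E by exact: measurable_funeneg.
apply/integrableP; split => //.
rewrite -[fun x => `|f x|%E]/(abse \o f) fune_abse ge0_integralD//.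
move: p0 n0 fpm; case: (integral _ _ f^\+%E) => [u| |];
  by case: (integral _ _ f^\-%E) => [v| |]; rewrite //= -?EFinD ?ltry.
Qed.

End reflection.

(** * A combination of three exponentials with prescribed signs *)

Section three_exponentials.
Context (R : realType).

(* Rolle gives a zero of [p'], unique because [p'(s) / expR (b1 * s)] is strictly
   monotone; [C] is chosen with the sign making it increasing. *)
Lemma expsum_sign (b1 b2 s1 s2 : R) :
    b1 != 0 -> b2 != 0 -> b1 != b2 -> s1 < s2 ->
  exists A B C : R, let p s := A + B * expR (b1 * s) + C * expR (b2 * s) in
  [/\ forall s, s < s1 -> 0 < p s,
      forall s, s1 <= s <= s2 -> p s <= 0 &
      forall s, s2 < s -> 0 < p s].
Proof.
move=> b10 b20 b12 s12.
have injE (b x y : R) : b != 0 -> x != y -> expR (b * x) - expR (b * y) != 0.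
  move=> b0; apply: contra; rewrite subr_eq0 => /eqP/expR_inj/(mulfI b0)/eqP.
  by [].
have s21 : s2 != s1 by rewrite gt_eqF.
pose d := b2 - b1.
have d0 : d != 0 by rewrite subr_eq0 eq_sym.
(* As [C * b2 = d], the derivative of [p] is [expR (b1 * s) * g s], where [g] increases whatever the
   signs of [b1] and [b2]. Then [B] solves [p s2 = p s1], and [A] solves [p s1 = 0]. *)
pose C := d / b2.
pose B := - C * (expR (b2 * s2) - expR (b2 * s1)) /
          (expR (b1 * s2) - expR (b1 * s1)).
pose A := - (B * expR (b1 * s1) + C * expR (b2 * s1)).
pose p s := A + B * expR (b1 * s) + C * expR (b2 * s).
pose g s := B * b1 + d * expR (d * s).
have ps1 : p s1 = 0 by rewrite /p /A; ring.
have ps2 : p s2 = 0.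
  by rewrite /p /A /B; field; exact: injE.
have dE (b s : R) : is_derive s 1 (fun s => expR (b * s)) (b * expR (b * s)).
  by apply: trigger_derive; rewrite /GRing.scale/= mulr1 mulrC.
have dp (s : R) : is_derive s 1 p (expR (b1 * s) * g s).
  have -> : p = (cst A + (B \*: (fun s => expR (b1 * s))))
              + (C \*: (fun s => expR (b2 * s))) by apply/funext.
  apply: is_derive_eq; rewrite /GRing.scale/= /g.
  have -> : b2 * s = b1 * s + d * s by rewrite /d; ring.
  by rewrite expRD /C; field.
have mvt x y : x < y ->
    exists2 c, x < c < y & p y - p x = expR (b1 * c) * g c * (y - x).
  move=> xy; have [|c cxy E] := MVT xy (fun c _ => dp c).
    apply: derivable_within_continuous => z _.
    by have [] := dp z.
  by exists c.
have gmono x y : x < y -> g x < g y.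
  move=> xy; rewrite /g ltrD2l.
  have := d0; rewrite neq_lt => /orP[dn|dp0].
    by rewrite ltr_nM2l// ltr_expR ltr_nM2l.
  by rewrite ltr_pM2l// ltr_expR ltr_pM2l.
have [c0 /andP[sc0 c0s] gc0] : exists2 c, s1 < c < s2 & g c = 0.
  have [c cs] := mvt _ _ s12; rewrite ps1 ps2 subr0 => /esym/eqP.
  rewrite !mulf_eq0 subr_eq0 (negbTE s21) orbF gt_eqF ?expR_gt0//= => /eqP.
  by exists c.
have glt0 c : c < c0 -> g c < 0 by move=> /gmono; rewrite gc0.
have ggt0 c : c0 < c -> 0 < g c by move=> /gmono; rewrite gc0.
exists A, B, C; rewrite /= -/(p _); split => s.
- move=> ss1; have [c /andP[_ cs1]] := mvt _ _ ss1.
  rewrite ps1 sub0r => E.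
  rewrite -oppr_lt0 [ltLHS]E -mulrA pmulr_rlt0 ?expR_gt0//.
  by rewrite pmulr_llt0 ?subr_gt0// glt0// (lt_trans cs1).
- move=> /andP[]; rewrite le_eqVlt => /predU1P[<- _|s1s].
    by rewrite [leLHS]ps1.
  rewrite le_eqVlt => /predU1P[->|ss2]; first by rewrite [leLHS]ps2.
  (* [p] decreases from [p s1 = 0] up to [c0], then increases to [p s2 = 0]. *)
  have [sc|cs] := leP s c0.
    have [c /andP[_ cs]] := mvt _ _ s1s; rewrite ps1 subr0 => E.
    rewrite [leLHS]E -mulrA pmulr_rle0 ?expR_gt0// pmulr_lle0 ?subr_gt0// ltW// glt0//.
    exact: lt_le_trans sc.
  have [c /andP[sc _]] := mvt _ _ ss2; rewrite ps2 sub0r => E.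
  rewrite -oppr_ge0 [leRHS]E -mulrA pmulr_rge0 ?expR_gt0// pmulr_lge0 ?subr_gt0//.
  by rewrite ltW// ggt0// (lt_trans cs).
- move=> s2s; have [c /andP[s2c _]] := mvt _ _ s2s.
  rewrite ps2 subr0 => E; rewrite [ltRHS]E -mulrA pmulr_rgt0 ?expR_gt0//.
  by rewrite pmulr_lgt0 ?subr_gt0// ggt0// (lt_trans c0s).
Qed.

End three_exponentials.

(** * Integration against a measure with a density *)

Section density_change.
Context (R : realType).
Local Notation mu := (@lebesgue_measure R).
Import HBNNSimple.

(** For a simple function this is the hypothesis applied to level sets; monotone convergence along
    one approximating sequence passes both sides to the limit. *)
Lemma ge0_integral_density (nu : {measure set R -> \bar R}) (h : R -> R)
    (f : R -> \bar R) :
    measurable_fun setT h -> (forall x, 0 <= h x) ->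
    (forall A, measurable A -> nu A = \int[mu]_(x in A) (h x)%:E)%E ->
    measurable_fun setT f -> (forall x, 0 <= f x)%E ->
  (\int[nu]_x f x = \int[mu]_x (f x * (h x)%:E))%E.
Proof.
move=> mh h0 nuE mf f0.
have mhE : measurable_fun setT (EFin \o h) by exact/measurable_EFinP.
have hE0 x : (0 <= (h x)%:E)%E by rewrite lee_fin.
pose f_ := nnsfun_approx measurableT mf.
have mf_ n : measurable_fun setT (fun x => (f_ n x)%:E) by exact/measurable_EFinP.
transitivity (limn (fun n => \int[nu]_x (f_ n x)%:E))%E.
  rewrite -monotone_convergence//=.
  - apply: eq_integral => x _; apply/esym/cvg_lim => //.
    exact: cvg_nnsfun_approx.
  - by move=> n x _; rewrite lee_fin.
  - by move=> x _ m n mn; rewrite lee_fin; exact/lefP/nd_nnsfun_approx.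
transitivity (limn (fun n => \int[mu]_x ((f_ n x)%:E * (h x)%:E)))%E; last first.
  rewrite -monotone_convergence//=.
  - apply: eq_integral => x _; apply/cvg_lim => //.
    by apply: cvgeZr => //; apply: cvg_nnsfun_approx.
  - by move=> n; exact: (emeasurable_funM (mf_ n) mhE).
  - by move=> n x _; rewrite mule_ge0// lee_fin.
  - move=> x _ m n mn; apply: lee_wpmul2r => //.
    by rewrite lee_fin; have /lefP/(_ x) := nd_nnsfun_approx measurableT mf mn.
congr (limn _); apply/funext => n.
under [LHS]eq_integral do rewrite fimfunE -fsumEFin//.
under [RHS]eq_integral => x _.
  rewrite fimfunE -fsumEFin// ge0_mule_fsuml; last first.
    by move=> r; rewrite EFinM nnfun_muleindic_ge0.
  over.
rewrite ge0_integral_fsum//; last 2 first.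
- by move=> r; exact/measurable_EFinP/measurableT_comp.
- by move=> r x _; rewrite EFinM nnfun_muleindic_ge0.
rewrite ge0_integral_fsum//; last 2 first.
- move=> r; apply: (emeasurable_funM _ mhE).
  exact/measurable_EFinP/measurableT_comp.
- by move=> r x _; rewrite mule_ge0// EFinM nnfun_muleindic_ge0.
apply: eq_fsbigr => r _; rewrite integralZl_indic_nnsfun//.
have mr : measurable (f_ n @^-1` [set r]) by exact: measurable_sfunP.
rewrite integral_indic//= setIT nuE// integral_mkcond.
(* A negative [r] has an empty level set; for [0 <= r] the constant may be moved inside the
   integral. *)
have [r0|r0] := ltP r 0.
  rewrite integral0_eq ?mule0; last first.
    by move=> x _; rewrite patchE preimage_nnfun0// in_set0.
  rewrite integral0_eq// => x _.
  by rewrite preimage_nnfun0// indic0 mulr0 mul0e.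
rewrite -ge0_integralZl//; last 2 first.
- by apply/(measurable_restrictT _ mr); exact: measurable_funTS.
- by move=> x _; rewrite patchE; case: ifP.
apply: eq_integral => x _; rewrite patchE indicE; case: ifPn => _.
  by rewrite mulr1.
by rewrite mulr0 mule0 mul0e.
Qed.

(** Multiplication by [h >= 0] commutes with taking positive and negative parts, so the two sides
    agree even when they are infinite. *)
Lemma integral_density (nu : {measure set R -> \bar R}) (h : R -> R)
    (f : R -> \bar R) :
    measurable_fun setT h -> (forall x, 0 <= h x) ->
    (forall A, measurable A -> nu A = \int[mu]_(x in A) (h x)%:E)%E ->
    measurable_fun setT f ->
  (\int[nu]_x f x = \int[mu]_x (f x * (h x)%:E))%E.
Proof.
move=> mh h0 nuE mf; rewrite integralE [RHS]integralE.
rewrite !(ge0_integral_density mh h0 nuE)//; last 2 first.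
- exact: measurable_funeneg.
- exact: measurable_funepos.
congr (_ - _)%E; apply: eq_integral => x _.
  by rewrite !funeposE maxe_pMl ?lee_fin// mul0e.
by rewrite !funenegE maxe_pMl ?lee_fin// mul0e mulNe.
Qed.

End density_change.

(** * Reduction of the re-weighted mean to one coordinate *)

Section product.
Context (R : realType).

(** Induction on [n]: Tonelli splits off the first coordinate, and nonnegativity allows infinite
    factors. *)
Lemma ge0_integral_product_prob n (mu : 'I_n -> probability R R)
    (f : 'I_n -> R -> R) :
    (forall i, measurable_fun setT (f i)) -> (forall i x, 0 <= f i x) ->
  (\int[product_prob mu]_x (\prod_(i < n) f i (tnth x i))%:E =
   \prod_(i < n) \int[mu i]_x (f i x)%:E)%E.
Proof.
elim: n mu f => [|n IHn] mu f mf f0.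
  rewrite big_ord0 /=.
  under eq_integral do rewrite big_ord0.
  by rewrite integral_cst// mul1e; exact: diracT.
rewrite big_ord_recl -IHn//=.
pose F (x : n.-tuple R) := \prod_(i < n) f (lift ord0 i) (tnth x i).
have mF : measurable_fun setT F.
  apply: measurable_prod => i _; apply: measurableT_comp => //.
  exact: measurable_tnth.
have F0 x : 0 <= F x by apply: prodr_ge0.
have mG : measurable_fun setT
    (fun x : n.+1.-tuple R => (\prod_(i < n.+1) f i (tnth x i))%:E).
  apply/measurable_EFinP; apply: measurable_prod => i _.
  by apply: measurableT_comp => //; exact: measurable_tnth.
rewrite ge0_integral_distribution//; last first.
  by move=> y; rewrite lee_fin prodr_ge0.
rewrite (_ : _ \o _ = fun z => (f ord0 z.1)%:E * (F z.2)%:E)%E; last first.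
  apply/funext => -[x t] /=; rewrite big_ord_recl EFinM; congr (_ * _%:E)%E.
  by apply: eq_bigr => i _; rewrite tnthS.
rewrite fubini_tonelli1/=; last 2 first.
- apply: emeasurable_funM; apply/measurable_EFinP.
    exact: measurableT_comp.
  exact: measurableT_comp.
- by move=> z; rewrite mule_ge0// lee_fin.
rewrite /fubini_F/=.
transitivity (\int[mu ord0]_x ((f ord0 x)%:E *
    \int[product_prob (fun i => mu (lift ord0 i))]_y (F y)%:E))%E.
  apply: eq_integral => x _; rewrite ge0_integralZl//.
  - exact/measurable_EFinP.
  - by move=> y _; rewrite lee_fin.
  - by rewrite lee_fin.
rewrite ge0_integralZr//.
- exact/measurable_EFinP.
- by move=> x _; rewrite lee_fin.
- by apply: integral_ge0 => y _; rewrite lee_fin.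
Qed.

Lemma integral_gt0_prob d (T : measurableType d) (P : probability T R)
    (f : T -> R) :
  measurable_fun setT f -> (forall x, 0 < f x) -> (0 < \int[P]_x (f x)%:E)%E.
Proof.
move=> mf f0; rewrite lt0e integral_ge0 ?andbT; last first.
  by move=> x _; rewrite lee_fin ltW.
apply/negP => /eqP int0.
have mfE : measurable_fun setT (EFin \o f) by exact/measurable_EFinP.
have : (\int[P]_x `|(EFin \o f) x| = 0)%E.
  by rewrite -[RHS]int0; apply: eq_integral => x _; rewrite gee0_abs ?lee_fin ?ltW.
move/(ae_eq_integral_abs P measurableT mfE) => -[N [mN N0 Nf]].
have : (P [set: T] <= P N)%E.
  apply: le_measure; rewrite ?inE// => x _; apply: Nf => /= /(_ I) [] fx.
  by have := f0 x; rewrite fx ltxx.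
by rewrite probability_setT N0 lee_fin ler10.
Qed.

(** Cancels the contribution [c] of the other coordinates, which may be [+oo]. In that case positive
    [p] and [m] would give [+oo - oo = -oo], which is not zero. *)
Lemma mule_subr_eq0 (p m c : \bar R) :
    (0 <= p)%E -> (0 <= m)%E -> (0 < c)%E -> (p * c - m * c = 0)%E ->
  (p - m = 0)%E.
Proof.
have oo_mul (x : \bar R) : (0 < x)%E -> (x * +oo = +oo)%E.
  by move=> x0; rewrite gt0_muley.
have mul_oo (x : \bar R) : (0 < x)%E -> (+oo * x = +oo)%E.
  by move=> x0; rewrite gt0_mulye.
rewrite le_eqVlt => /predU1P[<-|p0]; rewrite le_eqVlt => /predU1P[<-|m0] c0;
  rewrite ?mul0e ?sube0 ?sub0e//.
- by move/eqP; rewrite oppe_eq0 mule_eq0 !gt_eqF.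
- by move/eqP; rewrite mule_eq0 !gt_eqF.
- case: c c0 => [c||]// c0; last by rewrite !oo_mul.
  case: p p0 => [p||]// p0; last first.
    by rewrite mul_oo//; case: m m0 => [m||]// m0; rewrite ?mul_oo.
  case: m m0 => [m||]// m0; last by rewrite mul_oo.
  rewrite -!EFinM -!EFinB -mulrBl => -[]/eqP; rewrite mulf_eq0.
  by rewrite lte_fin in c0; rewrite (gt_eqF c0) orbF => /eqP ->.
Qed.

(** The exponential of the squared norm is a product over coordinates, so the integrand is a
    function of the [k]-th coordinate times a positive function of the others. Tonelli applies to
    its positive and negative parts separately, and the common factor cancels. *)
Lemma reweighted_mean_eq0 n (mu : 'I_n -> probability R R) (k : 'I_n)
    (al : R) :
    reweighted_mean (product_prob mu) (basis_vector R k) al = 0%E ->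
  (\int[mu k]_x (expR (al * x ^+ 2) * x)%:E = 0)%E.
Proof.
have dotE (x : n.-tuple R) : dot (basis_vector R k) x = tnth x k.
  rewrite /dot (bigD1 k)//= tnth_mktuple eqxx mul1r big1 ?addr0// => i ik.
  by rewrite tnth_mktuple (negbTE ik) mul0r.
pose w x := expR (al * x ^+ 2).
have mw : measurable_fun setT w.
  by apply: measurableT_comp => //; apply: measurable_funM => //; exact: measurable_funX.
pose wx x := w x * x.
have mwx : measurable_fun setT wx by exact: measurable_funM.
(* Below, [g] is the positive or the negative part of [wx]. *)
pose f (g : R -> R) i := if i == k then g else w.
have mf g : measurable_fun setT g -> forall i, measurable_fun setT (f g i).
  by move=> mg i; rewrite /f; case: ifP.
have f0 g : (forall x, 0 <= g x) -> forall i x, 0 <= f g i x.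
  by move=> g0 i x; rewrite /f; case: ifP => _ //; exact: expR_ge0.
pose W (x : n.-tuple R) := \prod_(i < n | i != k) w (tnth x i).
have W0 x : 0 <= W x by apply: prodr_ge0 => i _; exact: expR_ge0.
have prodf g (x : n.-tuple R) :
    \prod_(i < n) f g i (tnth x i) = W x * g (tnth x k).
  rewrite (bigD1 k)//= /f eqxx mulrC; congr (_ * _).
  by apply: eq_bigr => i /negbTE ->.
have intE (x : n.-tuple R) : expR (al * l2norm x ^+ 2) *
    dot (basis_vector R k) x = W x * wx (tnth x k).
  rewrite dotE /l2norm sqr_sqrtr; last by apply: sumr_ge0 => i _; rewrite sqr_ge0.
  rewrite mulr_sumr expR_sum (bigD1 k)//= /wx mulrA; congr (_ * _).
  by rewrite mulrC.
rewrite /reweighted_mean unlock.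
pose C := (\prod_(i < n | i != k) \int[mu i]_x (w x)%:E)%E.
have C0 : (0 < C)%E.
  apply: (big_ind (fun c : \bar R => (0 < c)%E)) => //.
    by move=> x y; exact: mule_gt0.
  by move=> i _; apply: integral_gt0_prob => // x; exact: expR_gt0.
have prodC (g : R -> R) : measurable_fun setT g -> (forall x, 0 <= g x) ->
    (\int[product_prob mu]_x (W x * g (tnth x k))%:E =
     \int[mu k]_x (g x)%:E * C)%E.
  move=> mg g0; under eq_integral do rewrite -prodf.
  rewrite ge0_integral_product_prob; [|exact: mf|exact: f0].
  rewrite (bigD1 k)//= /f eqxx; congr (_ * _)%E.
  by apply: eq_bigr => i /negbTE ->.
under eq_integral do rewrite intE.
rewrite integralE => E; rewrite integralE.
apply: (@mule_subr_eq0 _ _ C) => //.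
- by apply: integral_ge0.
- by apply: integral_ge0.
rewrite -[RHS]E; congr (_ - _)%E.
- transitivity (\int[mu k]_x (Num.max (wx x) 0)%:E * C)%E.
    congr (_ * _)%E; apply: eq_integral => x _.
    by rewrite (funeposE,funenegE) EFin_max.
  rewrite -prodC; last 2 first.
  + exact: measurable_maxr.
  + by move=> x; rewrite le_max lexx orbT.
  apply: eq_integral => x _.
  by rewrite funeposE -EFin_max maxr_pMr// mulr0.
- transitivity (\int[mu k]_x (Num.max (- wx x) 0)%:E * C)%E.
    congr (_ * _)%E; apply: eq_integral => x _.
    by rewrite (funeposE,funenegE) EFin_max.
  rewrite -prodC; last 2 first.
  + by apply: measurable_maxr => //; exact: measurableT_comp.
  + by move=> x; rewrite le_max lexx orbT.
  apply: eq_integral => x _.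
  by rewrite funenegE -EFinN -EFin_max maxr_pMr// mulr0 mulrN.
Qed.

End product.

(** * Contradiction from three vanishing integrals *)

Section two_zeros.
Context (R : realType).
Local Notation mu := (@lebesgue_measure R).

(** Up to a constant, the integrand of the mean of [margin_factor] re-weighted by [alpha], in the
    coordinate before standardization, with [be = alpha / v]. *)
Definition centered (q : R -> R) (a b m be x : R) : R :=
  expR (be * (x - m) ^+ 2) * (x - m) *
  (if x \in `[a, b] then 0 else q x).

Lemma measurable_centered (q : R -> R) (a b m be : R) :
  measurable_fun setT q -> measurable_fun setT (centered q a b m be).
Proof.
move=> mq.
have mxm : measurable_fun setT (fun x : R => x - m) by exact: measurable_funB.
apply: measurable_funM.
  apply: measurable_funM => //; apply: measurableT_comp => //.
  by apply: measurable_funM => //; exact: measurable_funX.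
apply: measurable_fun_ifT => //.
apply: (@measurable_fun_bool _ _ _ _ true).
rewrite setTI (_ : _ @^-1` _ = `[a, b]%classic)//.
Qed.

(** Suppose [0 <= m] and fold [(m - x) * r x] at [0]. As [0 < a + b], for [0 <= x] the point [x] is
    in the margin whenever [- x] is, so [r x <= r (- x)] and the fold is nonnegative with integral
    zero. But it is positive for [|a| < x < b], where [x] lies in the margin and [- x] does not. *)
Lemma center_lt0 (q : R -> R) (a b m : R) :
    measurable_fun setT q -> (forall x, 0 <= q x) ->
    (forall x y, `|x| <= `|y| -> q y <= q x) ->
    a < b -> 0 < a + b -> (exists2 c, b < c & 0 < q c) ->
    (\int[mu]_x (centered q a b m 0 x)%:E = 0)%E ->
  m < 0.
Proof.
move=> mq q0 qle ab ab_pos [c bc qc] centered0.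
pose r x := if x \in `[a, b] then 0 else q x.
have r0 x : 0 <= r x by rewrite /r; case: ifP.
have rleq x : r x <= q x by rewrite /r; case: ifP.
rewrite ltNge; apply/negP => m0.
have cE x : - centered q a b m 0 x = (m - x) * r x.
  by rewrite /centered mul0r expR0 mul1r -mulNr opprB.
have intc : mu.-integrable setT (EFin \o centered q a b m 0).
  apply: integral_eq0_integrable => //.
  by apply/measurable_EFinP; exact: measurable_centered.
have intN : mu.-integrable setT (EFin \o (fun x => - centered q a b m 0 x)).
  exact: (integrableN intc).
have intN0 : (\int[mu]_x (- centered q a b m 0 x)%:E = 0)%E.
  have := integralN (integrable_add_def measurableT intc).
  by rewrite /= centered0 oppe0.
have rr (x : R) : 0 <= x -> x * r x <= x * r (- x).
  move=> x0; apply: ler_wpM2l => //; rewrite {2}/r; case: ifPn => [|_].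
    rewrite in_itv/= /r => /andP[ax xb]; rewrite ifT// in_itv/=.
    by apply/andP; split; lra.
  by rewrite (le_trans (rleq x))// qle// normrN.
have ge0 x : 0 <= - centered q a b m 0 x + - centered q a b m 0 (0 - x).
  rewrite !cE sub0r opprK.
  rewrite (_ : _ + _ = (x * r (- x) - x * r x) + m * (r x + r (- x))); last by ring.
  apply: addr_ge0; last by rewrite mulr_ge0 ?addr_ge0.
  rewrite subr_ge0.
  have [/rr//|x0] := leP 0 x.
  by have := rr (- x); rewrite opprK; lra.
have := ae_eq0_reflect intN intN0 ge0.
have ab' : `|a| < b by rewrite ltr_norml; apply/andP; split; lra.
move=> /(ae_exists_itv ab')[x /andP[ax xb]].
rewrite !cE sub0r opprK.
have x0 : 0 < x by rewrite (le_lt_trans _ ax).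
have /andP[xa ax'] : - x < a < x by rewrite -ltr_norml.
have -> : r x = 0 by rewrite /r ifT// in_itv/= !ltW.
have -> : r (- x) = q x.
  rewrite /r ifF; last by rewrite in_itv/= leNgt xa.
  by apply/eqP; rewrite eq_le !qle ?normrN.
rewrite mulr0 add0r => /eqP; rewrite mulf_eq0 => /orP[/eqP|/eqP qx]; first lra.
have : q c <= q x by apply: qle; rewrite !gtr0_norm; lra.
by rewrite qx leNgt qc.
Qed.

Lemma centered_two_zeros (q : R -> R) (a b m b1 b2 : R) :
    measurable_fun setT q -> (forall x, 0 <= q x) ->
    (forall x y, `|x| <= `|y| -> q y <= q x) ->
    a < b -> 0 < a + b -> (exists2 c, b < c & 0 < q c) ->
    (\int[mu]_x (centered q a b m 0 x)%:E = 0)%E ->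
    mu.-integrable setT (EFin \o q) ->
  b1 != 0 -> b2 != 0 -> b1 != b2 ->
  (\int[mu]_x (centered q a b m b1 x)%:E = 0)%E ->
  (\int[mu]_x (centered q a b m b2 x)%:E = 0)%E -> False.
Proof.
move=> mq q0 qle ab ab_pos qpos centered0 intq b10 b20 b12 c10 c20.
have m0 := center_lt0 mq q0 qle ab ab_pos qpos centered0.
have [c bc qc] := qpos.
pose r x := if x \in `[a, b] then 0 else q x.
have r0 x : 0 <= r x by rewrite /r; case: ifP.
have rleq x : r x <= q x by rewrite /r; case: ifP.
have b0 : 0 < b by lra.
(* The margin in the folded coordinate [x - m >= 0]; the maximum covers the case where [m] is not to
   the left of [a]. *)
pose c1 := Num.max (a - m) 0; pose c2 := b - m.
have c1ge0 : 0 <= c1 by rewrite /c1 le_max lexx orbT.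
have c12 : c1 < c2 by rewrite gt_max /c2; apply/andP; split; lra.
have c2gt0 : 0 < c2 by exact: le_lt_trans c12.
have c12s : c1 ^+ 2 < c2 ^+ 2 by rewrite ltr_sqr ?nnegrE// ltW.
have [A [B [C]]] := expsum_sign b10 b20 b12 c12s.
set p := fun s => _ => -[plt pmid pgt].
pose F x := p ((x - m) ^+ 2) * (x - m) * r x.
have FE x : F x = A * centered q a b m 0 x + B * centered q a b m b1 x
                  + C * centered q a b m b2 x.
  by rewrite /F /p /centered mul0r expR0 -/(r x); ring.
have intc be : (\int[mu]_x (centered q a b m be x)%:E = 0)%E ->
    mu.-integrable setT (EFin \o centered q a b m be).
  apply: integral_eq0_integrable; apply/measurable_EFinP.
  exact: measurable_centered.
have null_lin (f g : R -> R) (k : R) :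
    mu.-integrable setT (EFin \o f) /\ (\int[mu]_x (f x)%:E = 0)%E ->
    mu.-integrable setT (EFin \o g) /\ (\int[mu]_x (g x)%:E = 0)%E ->
    mu.-integrable setT (EFin \o (fun x => f x + k * g x)) /\
    (\int[mu]_x (f x + k * g x)%:E = 0)%E.
  move=> [intf f0] [intg g0].
  have intkg : mu.-integrable setT (EFin \o (fun x => k * g x)).
    exact: (integrableZl measurableT k intg).
  split; first exact: (integrableD measurableT intf intkg).
  have /= := integralD_EFin measurableT intf intkg; rewrite f0 add0e => ->.
  by have /= := integralZl measurableT intg k; rewrite g0 mule0.
have [intF F0] : mu.-integrable setT (EFin \o F) /\ (\int[mu]_x (F x)%:E = 0)%E.
  have -> : F = fun x => (0 + A * centered q a b m 0 x
      + B * centered q a b m b1 x) + C * centered q a b m b2 x.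
    by apply/funext => x; rewrite add0r FE.
  do 3 (apply: (null_lin (fun x => _) (centered _ _ _ _ _)); last first;
    first by split => //; exact: intc).
  by split; [exact: integrable0|exact: integral0].
have FR x : F x + F (m *+ 2 - x) =
    p ((x - m) ^+ 2) * ((x - m) * (r x - r (m *+ 2 - x))).
  rewrite /F (_ : m *+ 2 - x - m = - (x - m)); last by ring.
  by rewrite sqrrN; ring.
(* In the margin [r x = 0] and [p] is nonpositive. Outside it [p] is positive, and [m < 0] makes [x]
   at least as close to [0] as its reflection, so [q] is at least as large at [x]. *)
have FR0 x : m <= x -> 0 <= p ((x - m) ^+ 2) * (r x - r (m *+ 2 - x)).
  move=> mx; have ym0 : 0 <= x - m by rewrite subr_ge0.
  have [xab|xab] := boolP (x \in `[a, b]).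
    have -> : r x = 0 by rewrite /r xab.
    rewrite sub0r mulrN -mulNr mulr_ge0// oppr_ge0 pmid//.
    move: xab; rewrite in_itv/= => /andP[ax xb].
    rewrite !ler_sqr ?nnegrE//; last exact: ltW.
    by rewrite ge_max ym0 andbT /c2; apply/andP; split; lra.
  have rx : r x = q x by rewrite /r (negbTE xab).
  apply: mulr_ge0.
    move: xab; rewrite in_itv/= negb_and -!ltNge => /orP[xa|bx].
      apply/ltW/plt; rewrite ltr_sqr ?nnegrE// /c1 lt_max; apply/orP; left; lra.
    apply/ltW/pgt; rewrite ltr_sqr ?nnegrE//; last exact: ltW.
    rewrite /c2; lra.
  rewrite subr_ge0 rx (le_trans (rleq _))// qle//.
  rewrite [leRHS]ler0_norm; last lra.
  by rewrite ler_norml; apply/andP; split; lra.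
(* Both [x - m] and [r x - r (m *+ 2 - x)] change sign under the reflection, so the case [x < m]
   reduces to the other. *)
have Fge0 x : 0 <= F x + F (m *+ 2 - x).
  rewrite FR mulrCA; have [mx|xm] := leP m x.
    by rewrite mulr_ge0 ?FR0// subr_ge0.
  have := FR0 (m *+ 2 - x).
  rewrite (_ : m *+ 2 - x - m = - (x - m)); last by ring.
  rewrite (_ : m *+ 2 - (m *+ 2 - x) = x); last by ring.
  rewrite sqrrN => FR0'.
  rewrite -mulrNN mulr_ge0//; first by rewrite oppr_ge0 subr_le0 ltW.
  by rewrite -mulrN opprB FR0'//; lra.
have ae0 := ae_eq0_reflect intF F0 Fge0.
(* The reflection of [y] at [m] is [- (y + d *+ 2)], so by evenness the fold compares [q y] with
   [q (y + d *+ 2)]. *)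
pose d := - m.
have d0 : 0 < d by rewrite oppr_gt0.
(* Agreement of [q] with its translate by [2 d] at a single point near [x]
   suffices, since [q] is monotone between the two points. *)
have qd x : b < x -> q (x + d) = q x.
  move=> bx; pose l := Num.max b (x - d).
  have lx : l < x by rewrite gt_max bx/=; lra.
  (* The choice of [l] gives [b < y] and [y < x < x + d < y + d *+ 2]. *)
  have [y /andP[ly yx] Fy] := ae_exists_itv lx ae0.
  move: ly; rewrite gt_max => /andP[bY xdy].
  have ry : r y = q y by rewrite /r ifF// in_itv/= (leNgt y) bY andbF.
  have rmy : r (m *+ 2 - y) = q (y + d *+ 2).
    rewrite /r ifF; last first.
      rewrite in_itv/=; apply/negbTE; rewrite negb_and -!ltNge; apply/orP; left; lra.
    rewrite (_ : m *+ 2 - y = - (y + d *+ 2)); last by rewrite /d; ring.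
    by apply/eqP; rewrite eq_le !qle ?normrN.
  have yy : q y = q (y + d *+ 2).
    move/eqP: Fy; rewrite FR ry rmy mulf_eq0 gt_eqF; last first.
      apply: pgt; rewrite ltr_sqr ?nnegrE; [rewrite /c2; lra|exact: ltW|lra].
    rewrite mulf_eq0/= gt_eqF/=; last lra.
    by rewrite subr_eq0 => /eqP.
  have le1 u v : b < u -> u <= v -> q v <= q u.
    by move=> bu uv; apply: qle; rewrite !gtr0_norm; lra.
  apply/eqP; rewrite eq_le le1//=; last lra.
  apply: (le_trans (le1 y x bY (ltW yx))).
  by rewrite yy le1//; rewrite /d in xdy *; lra.
have qdn n : q (c + d *+ n) = q c.
  elim: n => [|n IHn]; first by rewrite mulr0n addr0.
  rewrite mulrS (addrC d) addrA qd//.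
  by rewrite (lt_le_trans bc)// lerDl mulrn_wge0// ltW.
(* Some [c + d *+ n] exceeds [|x|], and [q] still has the value [q c] there. *)
have qge x : q c <= q x.
  rewrite -(qdn (Num.truncn (`|x| / d)).+1) qle//.
  have xd : `|x| < d *+ (Num.truncn (`|x| / d)).+1.
    by rewrite -mulr_natr mulrC -ltr_pdivrMr// truncnS_gt.
  set e := d *+ _ in xd *; have := normr_ge0 x => x0.
  by rewrite [leRHS]ger0_norm; lra.
have := integrable_lty measurableT intq; apply/negP; rewrite -leNgt.
apply: (@le_trans _ _ (\int[mu]_x (q c)%:E)%E).
  rewrite integral_cst//= -set_itvNyy lebesgue_measure_itv/= gt0_muley//.
apply: ge0_le_integral => //=.
- by move=> x _; rewrite lee_fin ltW.
- exact: measurable_int intq.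
- by move=> x _; rewrite lee_fin.
Qed.

End two_zeros.

(** * Unimodality, symmetry and the restricted density *)

Section margin.
Context (R : realType).
Local Notation mu := (@lebesgue_measure R).

(** For [|x| < |y|], the point [x] is the convex combination of [y] and [- y] with weight
    [t = (1 + x / y) / 2] on [y], and [q] takes the same value at both. *)
Lemma logconcave_unimodal (q : R -> R) :
    (forall x, 0 <= q x) -> symmetric_about0 q -> logconcave q ->
  forall x y, `|x| <= `|y| -> q y <= q x.
Proof.
move=> q0 qsym qlog x y xy.
have [->//|xy0] := eqVneq x y.
have [->|xNy] := eqVneq x (- y); first by rewrite qsym.
have y0 : y != 0.
  apply: contra_neq xy0 => y0; move: xy.
  by rewrite y0 normr0 normr_le0 => /eqP.
have lt1 : `|x / y| < 1.
  rewrite normrM normfV ltr_pdivrMr ?normr_gt0// mul1r lt_neqAle xy andbT.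
  by rewrite eqr_norm2 negb_or xy0.
pose t := (1 + x / y) / 2.
have /andP[t0 t1] : 0 < t < 1.
  by move: lt1; rewrite ltr_norml /t => /andP[? ?]; apply/andP; split; lra.
have := qlog y (- y) t t0 t1.
rewrite qsym (_ : t * y + _ = x); last by rewrite /t; field.
apply: le_trans; have [->|qy0] := eqVneq (q y) 0.
  by rewrite mulr_ge0// powR_ge0.
by rewrite -powRD ?qy0 ?implybT// addrC subrK powRr1.
Qed.

(** Treating positive and negative parts separately gives the change of variables also for infinite
    integrals. *)
Lemma integral_pushforward_measurable d1 d2 (X : measurableType d1)
    (Y : measurableType d2) (nu : {measure set X -> \bar R}) (phi : X -> Y)
    (f : Y -> \bar R) :
    measurable_fun setT phi -> measurable_fun setT f ->
  (\int[pushforward nu phi]_y f y = \int[nu]_x (f \o phi) x)%E.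
Proof.
move=> mphi mf; rewrite [LHS]integralE [RHS]integralE.
rewrite ge0_integral_pushforward//; last exact: measurable_funepos.
rewrite [X in (_ - X)%E = _]ge0_integral_pushforward//; last first.
  exact: measurable_funeneg.
by rewrite (funepos_comp f phi) (funeneg_comp f phi).
Qed.

Lemma density_prob_pos (q : density R) (A : set R) :
  (0 < density_prob q A)%E -> exists2 x, A x & 0 < q x.
Proof.
move=> qA; apply: contrapT => nq; move: qA.
rewrite /density_prob integral0_eq ?ltxx//.
move=> x Ax; congr EFin; apply/eqP.
rewrite eq_le pdf_ge0 andbT leNgt; apply/negP => qx.
by apply: nq; exists x.
Qed.

(** Reduces [a + b < 0] to [a + b > 0]: reflection at [0] carries the margin to [[- b, - a]] and the
    center to [- m]. *)
Lemma centeredN (q : R -> R) (a b m be x : R) : symmetric_about0 q ->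
  centered q (- b) (- a) (- m) be x = - centered q a b m be (0 - x).
Proof.
move=> qsym; rewrite /centered sub0r qsym opprK.
rewrite (_ : - x - m = - (x + m)); last by ring.
rewrite sqrrN mulrN mulNr opprK; congr (_ * _).
by rewrite !in_itv/= lerNl lerNr andbC.
Qed.

Lemma integral_centeredN (q : R -> R) (a b m be : R) :
    measurable_fun setT q -> symmetric_about0 q ->
    (\int[mu]_x (centered q a b m be x)%:E = 0)%E ->
  (\int[mu]_x (centered q (- b) (- a) (- m) be x)%:E = 0)%E.
Proof.
move=> mq qsym c0.
have intc : mu.-integrable setT (EFin \o centered q a b m be).
  apply: integral_eq0_integrable => //.
  by apply/measurable_EFinP; exact: measurable_centered.
have [intr r0] := integral_reflect 0 intc.
transitivity (\int[mu]_x (- (centered q a b m be (0 - x))%:E))%E.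
  by apply: eq_integral => x _; rewrite centeredN// EFinN.
rewrite integralN/=; first by rewrite r0 c0 oppe0.
exact: (integrable_add_def measurableT intr).
Qed.

Lemma centered_two_zeros_sym (q : R -> R) (a b m b1 b2 : R) :
    measurable_fun setT q -> (forall x, 0 <= q x) ->
    (forall x y, `|x| <= `|y| -> q y <= q x) ->
    a < b -> a + b != 0 ->
    (exists2 c, c < a & 0 < q c) -> (exists2 c, b < c & 0 < q c) ->
    mu.-integrable setT (EFin \o q) ->
    (\int[mu]_x (centered q a b m 0 x)%:E = 0)%E ->
  b1 != 0 -> b2 != 0 -> b1 != b2 ->
  (\int[mu]_x (centered q a b m b1 x)%:E = 0)%E ->
  (\int[mu]_x (centered q a b m b2 x)%:E = 0)%E -> False.
Proof.
move=> mq q0 qle ab abn0 [c ca qc] qb intq c00 b10 b20 b12 c10 c20.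
have qsym : symmetric_about0 q.
  by move=> x; apply/eqP; rewrite eq_le !qle ?normrN.
move: abn0; rewrite neq_lt => /orP[abn|abp]; last first.
  exact: (centered_two_zeros mq q0 qle ab abp qb c00 intq b10 b20 b12 c10 c20).
apply: (@centered_two_zeros _ q (- b) (- a) (- m) b1 b2) => //.
- by rewrite ltrN2.
- by lra.
- by exists (- c); rewrite ?ltrN2// qsym.
- exact: integral_centeredN.
- exact: integral_centeredN.
- exact: integral_centeredN.
Qed.

Lemma fine_outside_gt0 (q : density R) (a b : R) :
  (0 < density_prob q (~` `[a, b]))%E -> 0 < fine (density_prob q (~` `[a, b])).
Proof.
move=> Z0; rewrite fine_gt0// Z0/= ltey_eq fin_num_measure//.
exact: measurable_outside.
Qed.

Definition restricted_pdf (q : density R) (a b x : R) : R :=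
  if x \in `[a, b] then 0 else q x / fine (density_prob q (~` `[a, b])).

Lemma restricted_pdf_ge0 (q : density R) (a b x : R) :
  (0 < density_prob q (~` `[a, b]))%E -> 0 <= restricted_pdf q a b x.
Proof.
rewrite /restricted_pdf => /fine_outside_gt0 Z0; case: ifP => // _.
by rewrite divr_ge0 ?pdf_ge0// ltW.
Qed.

Lemma measurable_restricted_pdf (q : density R) (a b : R) :
  measurable_fun setT (restricted_pdf q a b).
Proof.
apply: measurable_fun_ifT => //.
  apply: (@measurable_fun_bool _ _ _ _ true).
  by rewrite setTI (_ : _ @^-1` _ = `[a, b]%classic).
by apply: measurable_funM => //; exact: measurable_pdf.
Qed.

Lemma integral_restricted_prob (q : density R) (a b : R) (f : R -> R) :
    (0 < density_prob q (~` `[a, b]))%E -> measurable_fun setT f ->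
  (\int[restricted_prob q a b]_x (f x)%:E =
   \int[mu]_x (f x * restricted_pdf q a b x)%:E)%E.
Proof.
move=> Z0 mf; rewrite (@integral_density _ _ (restricted_pdf q a b))//.
- exact: measurable_restricted_pdf.
- by move=> x; exact: restricted_pdf_ge0.
- by move=> A mA; exact: restricted_probE.
- exact/measurable_EFinP.
Qed.

(** The restricted density is at most [q] divided by the remaining mass. *)
Lemma integrable_restricted_prob (q : density R) (a b : R) (f : R -> R) :
    (0 < density_prob q (~` `[a, b]))%E ->
    (density_prob q).-integrable setT (EFin \o f) ->
  (restricted_prob q a b).-integrable setT (EFin \o f).
Proof.
move=> Z0 intf; have mf : measurable_fun setT f.
  by apply/measurable_EFinP; exact: measurable_int intf.
have h0 x := restricted_pdf_ge0 x Z0.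
have mh := measurable_restricted_pdf q a b.
have Z_gt0 := fine_outside_gt0 Z0; set Z := fine _ in Z_gt0.
have mnf : measurable_fun setT (fun x => `|f x|) by exact: measurableT_comp.
have mq := measurable_pdf q.
apply/integrableP; split; first exact/measurable_EFinP.
move/integrableP : intf => [_].
rewrite (integral_density mq (@pdf_ge0 _ q))//=; last first.
  exact/measurable_EFinP.
rewrite integral_restricted_prob// => fy.
apply: (@le_lt_trans _ _ (Z^-1%:E * \int[mu]_x (`|f x| * q x)%:E)%E); last first.
  by apply: lte_mul_pinfty => //; rewrite lee_fin invr_ge0 ltW.
rewrite -ge0_integralZl//; last 3 first.
- by apply/measurable_EFinP/measurable_funM.
- by move=> x _; rewrite lee_fin mulr_ge0 ?pdf_ge0.
- by rewrite lee_fin invr_ge0 ltW.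
apply: ge0_le_integral => //.
- by move=> x _; rewrite lee_fin mulr_ge0.
- by apply/measurable_EFinP/measurable_funM.
- apply/measurable_EFinP/measurable_funM => //.
  exact/measurable_funM.
- move=> x _; rewrite -EFinM lee_fin [leRHS]mulrCA; apply: ler_wpM2l => //.
  rewrite /restricted_pdf; case: ifP => _; last by rewrite mulrC.
  by rewrite mulr_ge0 ?pdf_ge0// invr_ge0 ltW.
Qed.

(** The factor [k] absorbs the constant left by standardization. The vanishing integral yields
    integrability, so the nonzero constant [k / Z] can be divided out. *)
Lemma integral_centered_eq0 (q : density R) (a b m be k : R) :
    (0 < density_prob q (~` `[a, b]))%E -> k != 0 ->
    (\int[restricted_prob q a b]_x
       (expR (be * (x - m) ^+ 2) * (x - m) * k)%:E = 0)%E ->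
  (\int[mu]_x (centered q a b m be x)%:E = 0)%E.
Proof.
move=> Z0 k0; have Z_gt0 := fine_outside_gt0 Z0; set Z := fine _ in Z_gt0.
have mxm : measurable_fun setT (fun x : R => x - m) by exact: measurable_funB.
rewrite integral_restricted_prob//; last first.
  apply: measurable_funM => //; apply: measurable_funM => //.
  apply: measurableT_comp => //.
  by apply: measurable_funM => //; exact: measurable_funX.
have mc := measurable_centered a b m be (measurable_pdf q).
have E x : expR (be * (x - m) ^+ 2) * (x - m) * k * restricted_pdf q a b x =
           centered q a b m be x * (k / Z).
  by rewrite /centered /restricted_pdf; case: ifP => _; rewrite ?mulr0 ?mul0r//; ring.
under eq_integral do rewrite E.
move=> c0.
have kZ : k / Z != 0 by rewrite mulf_neq0// invr_eq0 gt_eqF.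
have intk : mu.-integrable setT (fun x => (centered q a b m be x * (k / Z))%:E).
  apply: integral_eq0_integrable => //.
  by apply/measurable_EFinP; exact: measurable_funM.
have := integralZl measurableT intk (k / Z)^-1.
rewrite c0 mule0 => <-; apply: eq_integral => x _.
by rewrite -EFinM mulrCA mulVf// mulr1.
Qed.

End margin.

(** * Moments of the restriction and conclusion *)

(** The second moment of [q] is finite, hence so is that of the restriction, and [fine] returns the
    true mean and variance. The variance is positive because the restriction has a positive density
    on []b, c[], so it is not concentrated at [m]. *)
Lemma restricted_moments (R : realType) (q : density R) (a b : R) :
    isotropic (density_prob q) ->
    (forall x y, `|x| <= `|y| -> q y <= q x) -> a < b ->
    (exists2 c, c < a & 0 < q c) -> (exists2 c, b < c & 0 < q c) ->
    (0 < density_prob q (~` `[a, b]))%E ->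
  let P := restricted_prob q a b in
  let m := fine 'E_P[id : R -> R] in
  (\int[P]_x (x - m)%:E = 0)%E /\ 0 < fine 'V_P[id : R -> R].
Proof.
move=> [EQ VQ] qle ab [c' ca qc'] [c bc qc] Z0 P m.
have sqrQ : (density_prob q).-integrable setT (EFin \o (fun x : R => x ^+ 2)).
  apply/integrableP; split.
    by apply/measurable_EFinP; exact: measurable_funX.
  rewrite (_ : integral _ _ _ = 1%E) ?ltry//.
  rewrite -VQ /variance !unlock; apply: eq_integral => x _.
  move: EQ; rewrite unlock => ->.
  rewrite /= ger0_norm ?sqr_ge0//.
  by transitivity ((x - 0) * (x - 0))%:E => //; rewrite subr0 expr2.
have sqrP : P.-integrable setT (EFin \o (fun x : R => x ^+ 2)).
  exact: integrable_restricted_prob.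
have cstP (r : R) : P.-integrable setT (EFin \o cst r).
  exact: finite_measure_integrable_cst.
(* Domination by [x ^+ 2 + 1]. *)
have idP : P.-integrable setT (EFin \o (fun x : R => x)).
  have := integrableD measurableT sqrP (cstP 1).
  apply: le_integrable => //; first exact/measurable_EFinP.
  move=> x _; rewrite /= lee_fin [leRHS]ger0_norm ?addr_ge0 ?sqr_ge0//.
  by rewrite ler_norml; apply/andP; split; nra.
have mE : (\int[P]_x x%:E = m%:E)%E.
  by rewrite /m unlock fineK// integrable_fin_num.
split.
  have cE : (\int[P]_x m%:E = m%:E)%E.
    transitivity (m%:E * P setT)%E; first exact: integral_cst.
    by rewrite probability_setT mule1.
  by have /= := integralB_EFin measurableT idP (cstP m); rewrite mE cE subee.
have mxm2 : measurable_fun setT (fun x : R => (x - m) ^+ 2).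
  by apply: measurable_funX; exact: measurable_funB.
have VE : 'V_P[id : R -> R] = (\int[P]_x ((x - m) ^+ 2)%:E)%E.
  rewrite /variance covariance.unlock -/m expectation.unlock.
  by apply: eq_integral => x _; rewrite /= expr2.
(* Domination by [2 * (x ^+ 2 + m ^+ 2)]. *)
have csqrP : P.-integrable setT (EFin \o (fun x : R => (x - m) ^+ 2)).
  have := integrableZl measurableT 2 (integrableD measurableT sqrP (cstP (m ^+ 2))).
  apply: le_integrable => //; first exact/measurable_EFinP.
  move=> x _; rewrite /= lee_fin !ger0_norm ?sqr_ge0 ?mulr_ge0 ?addr_ge0 ?sqr_ge0//.
  by have := sqr_ge0 (x + m); lra.
rewrite VE; apply: fine_gt0; rewrite integrable_lty// andbT lt0e.
rewrite integral_ge0 ?andbT; last by move=> x _; rewrite lee_fin sqr_ge0.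
apply/negP => /eqP V0.
move: V0; rewrite integral_restricted_prob//.
set h := restricted_pdf q a b => V0.
have h0 x : 0 <= h x by exact: restricted_pdf_ge0.
have mh : measurable_fun setT h by exact: measurable_restricted_pdf.
have mxh : measurable_fun setT (fun x : R => ((x - m) ^+ 2 * h x)%:E).
  by apply/measurable_EFinP; exact: measurable_funM.
have : (\int[lebesgue_measure]_x `|((x - m) ^+ 2 * h x)%:E| = 0)%E.
  rewrite -V0; apply: eq_integral => x _.
  by rewrite gee0_abs// lee_fin mulr_ge0// sqr_ge0.
move/(ae_eq_integral_abs (@lebesgue_measure R) measurableT mxh).
move=> ae0.
have nullP x : b < x -> x < c ->
    ([set: R] x -> ((x - m) ^+ 2 * h x)%:E = cst 0%E x) -> x = m.
  move=> bx xc /(_ I)[] /eqP; rewrite mulf_eq0 sqrf_eq0 subr_eq0.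
  move=> /orP[/eqP//|]; rewrite /h /restricted_pdf ifF; last first.
    by rewrite in_itv/= (leNgt x) bx andbF.
  rewrite gt_eqF// divr_gt0 ?fine_outside_gt0//.
  (* [x] is closer to [0] than [c] if it is nonnegative, and than [c'] if it is negative. *)
  have [x0|x0] := leP 0 x.
    by rewrite (lt_le_trans qc)// qle// !ger0_norm; lra.
  by rewrite (lt_le_trans qc')// qle// !ler0_norm; lra.
(* Each half of []b, c[] contains a point where the integrand vanishes, and both would have to equal
   [m]. *)
have bm : b < (b + c) / 2 by lra.
have mc : (b + c) / 2 < c by lra.
have [x /andP[bx xm] /nullP] := ae_exists_itv bm ae0.
have [y /andP[my yc] /nullP] := ae_exists_itv mc ae0.
move=> /(_ (lt_trans bm my) yc) ym /(_ bx (lt_trans xm mc)) xm'.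
by move: (lt_trans xm my); rewrite xm' ym ltxx.
Qed.

(** Substituting [(x - m) / Num.sqrt v] turns the exponent into [(al / v) * (x - m) ^+ 2] and leaves
    the constant factor [(Num.sqrt v)^-1]. *)
Lemma integral_margin_factor (R : realType) (q : density R) (a b al : R) :
    (0 < density_prob q (~` `[a, b]))%E ->
  let P := restricted_prob q a b in
  let m := fine 'E_P[id : R -> R] in
  let v := fine 'V_P[id : R -> R] in
    0 < v ->
    (\int[margin_factor q a b]_x (expR (al * x ^+ 2) * x)%:E = 0)%E ->
  (\int[lebesgue_measure]_x (centered q a b m (al / v) x)%:E = 0)%E.
Proof.
move=> Z0 P m v v0.
rewrite integral_pushforward_measurable//; last first.
  apply/measurable_EFinP; apply: measurable_funM => //.
  apply: measurableT_comp => //.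
  by apply: measurable_funM => //; exact: measurable_funX.
rewrite -/m -/v => c0.
have sv0 : (Num.sqrt v)^-1 != 0 by rewrite invr_eq0 gt_eqF// sqrtr_gt0.
apply: (integral_centered_eq0 Z0 sv0).
rewrite -[RHS]c0; apply: eq_integral => x _ /=; congr EFin.
rewrite /standardize exprMn exprVn sqr_sqrtr ?ltW// [RHS]mulrA.
by congr (expR _ * _ * _); ring.
Qed.

Theorem lemma1 (R : realType) (eps : R) (q : density R) (a b : R)
    (d : nat) (k : 'I_d) (alpha1 alpha2 : R) :
  0 < eps ->
  symmetric_about0 q ->
  isotropic (density_prob q) ->
  logconcave q ->
  a < b ->
  (eps%:E <= density_prob q `]-oo, a])%E ->
  (eps%:E <= density_prob q `[a, b])%E ->
  (eps%:E <= density_prob q `[b, +oo[)%E ->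
  0 < `|a + b| ->
  alpha1 != 0 -> alpha2 != 0 -> alpha1 != alpha2 ->
  (0 < maxe
    `| reweighted_mean (margin_product q a b k) (basis_vector R k) alpha1 |
    `| reweighted_mean (margin_product q a b k) (basis_vector R k) alpha2 |)%E.
Proof.
move=> eps0 qsym qiso qlog ab qa _ qb; rewrite normr_gt0 => ab0 al10 al20 al12.
have qle := logconcave_unimodal (@pdf_ge0 _ q) qsym qlog.
have mq := measurable_pdf q.
have mqE (A : set R) : measurable_fun A (EFin \o q).
  exact/measurable_EFinP/measurable_funTS.
(* Endpoints are null, so the open half-lines have positive mass too and contain points of positive
   density strictly outside the margin. *)
have qb' : (0 < density_prob q `]b, +oo[)%E.
  rewrite (lt_le_trans (y := eps%:E))// (le_trans qb)//.
  by rewrite /density_prob -integral_itv_obnd_cbnd.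
have qa' : (0 < density_prob q `]-oo, a[)%E.
  rewrite (lt_le_trans (y := eps%:E))// (le_trans qa)//.
  by rewrite /density_prob -integral_itv_bndo_bndc.
have qcb : exists2 c, b < c & 0 < q c.
  have [c] := density_prob_pos qb'.
  by rewrite /= in_itv/= andbT; exists c.
have qca : exists2 c, c < a & 0 < q c.
  by have [c] := density_prob_pos qa'; exists c.
have Z0 : (0 < density_prob q (~` `[a, b]))%E.
  apply: (lt_le_trans qb'); apply: le_measure; rewrite ?inE//.
    exact: measurable_outside.
  move=> x /=; rewrite !in_itv/= andbT => bx; apply/negP.
  by rewrite negb_and -!ltNge bx orbT.
have [c0 v0] := restricted_moments qiso qle ab qca qcb Z0.
set m := fine _ in c0; set v := fine _ in v0.
(* The third exponent, [0]: this is the definition of [m] as the mean. *)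
have c00 : (\int[lebesgue_measure]_x (centered q a b m 0 x)%:E = 0)%E.
  apply: (integral_centered_eq0 Z0 (oner_neq0 R)).
  rewrite -[RHS]c0; apply: eq_integral => x _.
  by rewrite mul0r expR0 mul1r mulr1.
have intq : lebesgue_measure.-integrable setT (EFin \o q).
  apply/integrableP; split; first exact/measurable_EFinP.
  rewrite (_ : integral _ _ _ = 1%E) ?ltry// -[RHS](integral_pdf q).
  by apply: eq_integral => x _; rewrite gee0_abs// lee_fin pdf_ge0.
have zero al : reweighted_mean (margin_product q a b k) (basis_vector R k) al
      = 0%E ->
    (\int[lebesgue_measure]_x (centered q a b m (al / v) x)%:E = 0)%E.
  by move/reweighted_mean_eq0; rewrite eqxx => /(integral_margin_factor Z0 v0).
rewrite lt_max !lt0e !abse_ge0 !andbT !abse_eq0 -negb_and.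
apply/negP => /andP[/eqP/zero z1 /eqP/zero z2].
have v1 : v^-1 != 0 by rewrite invr_eq0 gt_eqF.
apply: (centered_two_zeros_sym mq (@pdf_ge0 _ q) qle ab ab0 qca qcb intq c00 _ _ _ z1 z2).
- by rewrite mulf_neq0.
- by rewrite mulf_neq0.
- by apply: contra_neq al12 => /(mulIf v1).
Qed.
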